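(* Let $V$ be a separable left quaternionic Hilbert space, let $\Phi=\{\phi_k\}_{k\in I}$ be a (countable) sequence of elements of $V$, and let $\omega=\{\omega_k\}_{k\in I}$ be a sequence of positive, semi-normalized weights. Then the following conditions are equivalent: (i) $\{\phi_k\}_{k\in I}$ is a frame for $V$. (ii) $\mathbf{M}_{\omega,\Phi}$ is a (well-defined) positive and invertible operator on $V$, where $\mathbf{M}_{\omega,\Phi}\psi=\sum_{k\in I}\omega_k\langle\psi|\phi_k\rangle\phi_k$ for $\psi\in V$. (iii) There are constants $A>0$ and $B<\infty$ such that $$A\|\psi\|^2\le\sum_{k\in I}\omega_k|\langle\psi|\phi_k\rangle|^2\le B\|\psi\|^2\qquad\text{for all }\psi\in V.$$ (iv) $\{\sqrt{\omega_k}\,\phi_k\}_{k\in I}$ is a frame for $V$. (v) $\{\omega_k\phi_k\}_{k\in I}$ is a frame for $V$ (i.e., in this sense, the pair $\{\omega_k\},\{\phi_k\}$ forms a weighted frame).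
   Context: $\mathbb{H}$ denotes the quaternions, with conjugation $q\mapsto\overline{q}$. A left quaternionic Hilbert space $V$ is a left $\mathbb{H}$-vector space with an inner product $\langle\cdot|\cdot\rangle:V\times V\to\mathbb{H}$ that is additive in each variable and satisfies $\overline{\langle f|g\rangle}=\langle g|f\rangle$, $\langle f|f\rangle>0$ for $f\ne0$, $\langle qf|g\rangle=q\langle f|g\rangle$, $\langle f|qg\rangle=\langle f|g\rangle\overline{q}$, and is complete for the norm $\|f\|^2=\langle f|f\rangle$. Operators are left linear: additive with $T(qf)=q(Tf)$ for $q\in\mathbb{H}$. An operator $T$ on $V$ is positive if $\langle Tf|f\rangle$ is real and $\ge0$ for all $f\in V$. A countable family $\{\phi_k\}_{k\in I}$ in $V$ is a frame for $V$ if there are constants $A,B>0$ with $A\|\psi\|^2\le\sum_{k\in I}|\langle\psi|\phi_k\rangle|^2\le B\|\psi\|^2$ for all $\psi\in V$. Weights are real numbers; a sequence $\{\omega_k\}$ is positive if $\omega_k>0$ for all $k$, and semi-normalized if there are bounds $b\ge a>0$ with $a\le|\omega_k|\le b$ for all $k$. Well-definedness of $\mathbf{M}_{\omega,\Phi}$ in (ii) means that the defining series converges (unconditionally) in $V$ for every $\psi\in V$. *)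

(* Defs.v *)
From HB Require Import structures.
From mathcomp Require Import all_boot all_order all_algebra.
From mathcomp Require Import all_classical all_reals all_analysis.
From mathcomp.analysis.showcase Require summability.
From mathcomp Require Import ring.

Set Implicit Arguments.
Unset Strict Implicit.
Unset Printing Implicit Defensive.

Import Order.TTheory GRing.Theory Num.Theory.
Import numFieldNormedType.Exports.

Local Open Scope classical_set_scope.
Local Open Scope ring_scope.

Reserved Notation "x %:H" (at level 1, format "x %:H").

(* [Quat a b c d] is a + b i + c j + d k. *)
Record quat (R : Type) := Quat { qre : R; qi : R; qj : R; qk : R }.

Section QuatChoice.
Context {R : choiceType}.

Definition tuple_of_quat (q : quat R) := (qre q, qi q, qj q, qk q).
Definition quat_of_tuple (t : R * R * R * R) :=
  Quat t.1.1.1 t.1.1.2 t.1.2 t.2.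

Lemma tuple_of_quatK : cancel tuple_of_quat quat_of_tuple.
Proof. by case. Qed.

HB.instance Definition _ := Choice.copy (quat R) (can_type tuple_of_quatK).

End QuatChoice.

Section QuatRing.
Context {R : comNzRingType}.
Implicit Types p q r : quat R.

Definition qadd p q :=
  Quat (qre p + qre q) (qi p + qi q) (qj p + qj q) (qk p + qk q).

Definition qopp q := Quat (- qre q) (- qi q) (- qj q) (- qk q).

Definition qmul p q :=
  Quat (qre p * qre q - qi p * qi q - qj p * qj q - qk p * qk q)
       (qre p * qi q + qi p * qre q + qj p * qk q - qk p * qj q)
       (qre p * qj q - qi p * qk q + qj p * qre q + qk p * qi q)
       (qre p * qk q + qi p * qj q - qj p * qi q + qk p * qre q).

Definition qreal_embed (x : R) := Quat x 0 0 0.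

Definition qconj q := Quat (qre q) (- qi q) (- qj q) (- qk q).

Lemma qaddA : associative qadd.
Proof. by move=> [????] [????] [????]; congr Quat; rewrite /= addrA. Qed.

Lemma qaddC : commutative qadd.
Proof. by move=> [????] [????]; congr Quat; rewrite /= addrC. Qed.

Lemma qadd0 : left_id (qreal_embed 0) qadd.
Proof. by move=> [????]; congr Quat; rewrite /= add0r. Qed.

Lemma qaddN : left_inverse (qreal_embed 0) qopp qadd.
Proof. by move=> [????]; congr Quat; rewrite /= addNr. Qed.

HB.instance Definition _ :=
  GRing.isZmodule.Build (quat R) qaddA qaddC qadd0 qaddN.

Lemma qmulA : associative qmul.
Proof. by move=> [????] [????] [????]; congr Quat => /=; ring. Qed.

Lemma qmul1l : left_id (qreal_embed 1) qmul.
Proof. by move=> [????]; congr Quat => /=; ring. Qed.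

Lemma qmul1r : right_id (qreal_embed 1) qmul.
Proof. by move=> [????]; congr Quat => /=; ring. Qed.

Lemma qmulDl : left_distributive qmul +%R.
Proof. by move=> [????] [????] [????]; congr Quat => /=; ring. Qed.

Lemma qmulDr : right_distributive qmul +%R.
Proof. by move=> [????] [????] [????]; congr Quat => /=; ring. Qed.

Lemma qone_neq0 : qreal_embed 1 != 0.
Proof. by apply/eqP => -[] /eqP; rewrite oner_eq0. Qed.

HB.instance Definition _ :=
  GRing.Zmodule_isNzRing.Build (quat R)
    qmulA qmul1l qmul1r qmulDl qmulDr qone_neq0.

End QuatRing.

Notation "x %:H" := (qreal_embed x) : ring_scope.

Definition is_real_quat {R : comNzRingType} (q : quat R) : Prop :=
  q = (qre q)%:H.

Definition qabs {R : realType} (q : quat R) : R :=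
  Num.sqrt (qre q ^+ 2 + qi q ^+ 2 + qj q ^+ 2 + qk q ^+ 2).

HB.mixin Record hasQuatInner (R : realType) (V : Type)
    & GRing.Lmodule (quat R) V := {
  inner : V -> V -> quat R;
  innerDl : forall f g h, inner (f + g) h = inner f h + inner g h;
  innerDr : forall f g h, inner f (g + h) = inner f g + inner f h;
  inner_conj : forall f g, qconj (inner f g) = inner g f;
  inner_gt0 : forall f, f != 0 ->
    is_real_quat (inner f f) /\ 0 < qre (inner f f);
  innerZl : forall (q : quat R) f g, inner (q *: f) g = q * inner f g;
  innerZr : forall (q : quat R) f g, inner f (q *: g) = inner f g * qconj q
}.

#[short(type="quatPreHilbertType")]
HB.structure Definition QuatPreHilbert (R : realType) :=
  {V of GRing.Lmodule (quat R) V & hasQuatInner R V}.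

Definition hnorm {R : realType} {V : quatPreHilbertType R} (f : V) : R :=
  Num.sqrt (qre (inner f f)).

(* Convergence in norm along a filter. *)
Definition hcvg {R : realType} {V : quatPreHilbertType R} {T : Type}
    (F : set_system T) (u : T -> V) (l : V) : Prop :=
  hnorm (u t - l) @[t --> F] --> 0.

Definition hcauchy {R : realType} {V : quatPreHilbertType R}
    (u : nat -> V) : Prop :=
  forall e : R, 0 < e -> exists N : nat, forall m n : nat,
    (N <= m)%N -> (N <= n)%N -> hnorm (u m - u n) < e.

HB.mixin Record isQuatHilbert (R : realType) (V : Type)
    & QuatPreHilbert R V := {
  hilbert_complete : forall u : nat -> V,
    hcauchy u -> exists l : V, hcvg \oo u l
}.

#[short(type="quatHilbertType")]
HB.structure Definition QuatHilbert (R : realType) :=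
  {V of QuatPreHilbert R V & isQuatHilbert R V}.

Definition separable {R : realType} (V : quatPreHilbertType R) : Prop :=
  exists2 D : set V, countable D &
    forall (f : V) (e : R), 0 < e -> exists2 g, D g & hnorm (f - g) < e.

Definition semi_normalized {R : realType} {I : Type} (w : I -> R) : Prop :=
  exists a b, [/\ 0 < a, a <= b & forall k, a <= `|w k| <= b].

Section Frames.
Context {R : realType} {V : quatHilbertType R} {I : countType}.
Implicit Types (phi : I -> V) (w : I -> R) (T : {linear V -> V}).

Definition frame phi : Prop :=
  exists A B : R, [/\ 0 < A, 0 < B & forall psi : V,
    ((A * hnorm psi ^+ 2)%:E
       <= \esum_(k in [set: I]) (qabs (inner psi (phi k)) ^+ 2)%:E
       <= (B * hnorm psi ^+ 2)%:E)%E].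

Definition weighted_frame_bounds w phi : Prop :=
  exists A B : R, 0 < A /\ forall psi : V,
    ((A * hnorm psi ^+ 2)%:E
       <= \esum_(k in [set: I]) (w k * qabs (inner psi (phi k)) ^+ 2)%:E
       <= (B * hnorm psi ^+ 2)%:E)%E.

(* The unordered series over I with terms f converges to s: the net of partial
   sums, indexed by the finite subsets of I ordered by inclusion, tends to s. *)
Definition uncond_sum (f : I -> V) (s : V) : Prop :=
  hcvg summability.totally (summability.partial_sum f) s.

(* T is the (well-defined) multiplier with weights w and sequence phi. *)
Definition is_multiplier w phi T : Prop :=
  forall psi : V,
    uncond_sum (fun k => (w k)%:H *: (inner psi (phi k) *: phi k)) (T psi).

Definition positive_operator T : Prop :=
  forall f : V, is_real_quat (inner (T f) f) /\ 0 <= qre (inner (T f) f).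

(* As for all operators here, left linearity of the inverse is required, while
   boundedness is not part of the notion. *)
Definition invertible_operator T : Prop :=
  exists S : {linear V -> V}, cancel T S /\ cancel S T.

End Frames.

(* Main.v *)
(* (i), (iii), (iv) and (v) differ only by coefficients of the numbers
   [|<psi|phi_k>|^2] that are bounded above and away from 0.  A multiplier [M] is
   symmetric for the real inner product [Re <f|g>], with [<M f|f>] equal to the
   weighted sum of (iii).  If [M] is invertible, then [M] and its inverse are
   everywhere defined and symmetric, hence bounded (Hellinger-Toeplitz), and
   Cauchy-Schwarz for the form [<M f|g>] gives the lower bound.  Conversely (iii)
   makes the partial sums of the multiplier Cauchy and [M] coercive, and
   [M f = g] is solved by iterating the contraction [f |-> f + t (g - M f)]. *)
Require Import Defs.
From HB Require Import structures.
From mathcomp Require Import all_boot all_order all_algebra.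
From mathcomp Require Import all_classical all_reals all_analysis.
From mathcomp.analysis.showcase Require summability.
From mathcomp Require Import finmap ring lra.

Set Implicit Arguments.
Unset Strict Implicit.
Unset Printing Implicit Defensive.

Import Order.TTheory GRing.Theory Num.Theory.
Import numFieldNormedType.Exports.

Local Open Scope classical_set_scope.
Local Open Scope ring_scope.

(** This makes [V] a real inner product space with the same norm. The analysis runs over the reals,
    and quaternionic statements are recovered by testing against scalar multiples. *)
Definition rip {R : realType} {V : quatPreHilbertType R} (f g : V) : R :=
  qre (inner f g).

(** * Quaternion arithmetic and the real part *)

Section QuaternionIdentities.
Context {R : realType}.
Implicit Types (p q : quat R) (t : R).

Lemma qreM p q :
  qre (p * q) = qre p * qre q - qi p * qi q - qj p * qj q - qk p * qk q.
Proof. by case: p => ????; case: q. Qed.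

Lemma qreMC p q : qre (p * q) = qre (q * p).
Proof. by rewrite !qreM; ring. Qed.

Lemma qreD p q : qre (p + q) = qre p + qre q.
Proof. by case: p => ????; case: q. Qed.

Lemma qre_conj q : qre (qconj q) = qre q.
Proof. by []. Qed.

Lemma qconjM p q : qconj (p * q) = qconj q * qconj p.
Proof. by case: p => ????; case: q => ????; congr Quat => /=; ring. Qed.

Lemma qconjK : involutive (@qconj R).
Proof. by case=> ????; congr Quat => /=; rewrite opprK. Qed.

Lemma qreal_embed_conj t : qconj t%:H = t%:H.
Proof. by congr Quat => /=; rewrite oppr0. Qed.

Lemma qre_real_embedM t q : qre (t%:H * q) = t * qre q.
Proof. by rewrite qreM /=; ring. Qed.

Lemma sqr_qabs q :
  qabs q ^+ 2 = qre q ^+ 2 + qi q ^+ 2 + qj q ^+ 2 + qk q ^+ 2.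
Proof. by rewrite sqr_sqrtr// !addr_ge0// sqr_ge0. Qed.

Lemma qre_mul_conj q : qre (q * qconj q) = qabs q ^+ 2.
Proof. by rewrite sqr_qabs qreM /=; ring. Qed.

Lemma sqr_qabs_scale t q : qabs (q * t%:H) ^+ 2 = t ^+ 2 * qabs q ^+ 2.
Proof. by rewrite !sqr_qabs; case: q => ???? /=; ring. Qed.

(** The pairing Re (x p) is nondegenerate: taking x = 1, i, j, k reads off the four coordinates of p
    up to sign. *)
Lemma qre_mulP p q : (forall x, qre (x * p) = qre (x * q)) -> p = q.
Proof.
case: p => a b c d; case: q => a' b' c' d' H.
have := (H (Quat 1 0 0 0), H (Quat 0 1 0 0), H (Quat 0 0 1 0), H (Quat 0 0 0 1)).
rewrite !qreM /= => -[[[h1 h2] h3] h4].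
by congr Quat; lra.
Qed.

Lemma real_quatP q : qconj q = q -> is_real_quat q.
Proof. by case: q => a b c d [hb hc hd]; congr Quat; lra. Qed.

Lemma qreal_embedN t : (- t)%:H = - t%:H.
Proof. by congr Quat; rewrite oppr0. Qed.

End QuaternionIdentities.

(** * Cauchy-Schwarz for semidefinite real forms *)

Section SemidefiniteForms.
Context {R : realType} {V : lmodType (quat R)} (b : V -> V -> R).
Hypothesis b_add : forall f g h, b (f + g) h = b f h + b g h.
Hypothesis b_scale : forall (t : R) f g, b (t%:H *: f) g = t * b f g.
Hypothesis b_sym : forall f g, b f g = b g f.
Hypothesis b_ge0 : forall f, 0 <= b f f.

Lemma form_cauchy_schwarz f g : b f g ^+ 2 <= b f f * b g g.
Proof.
have E s t : b (s%:H *: f + t%:H *: g) (s%:H *: f + t%:H *: g) =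
    s ^+ 2 * b f f + 2 * s * t * b f g + t ^+ 2 * b g g.
  rewrite b_add !b_scale (b_sym f) (b_sym g) !b_add !b_scale (b_sym g f); ring.
have [gg0|gg0] := eqVneq (b g g) 0; last first.
  have gg : 0 < b g g by rewrite lt0r gg0 b_ge0.
  (* The component of [f] orthogonal to [g], multiplied by [b g g] to avoid a division. *)
  have := b_ge0 ((b g g)%:H *: f + (- b f g)%:H *: g); rewrite E.
  rewrite [X in 0 <= X](_ : _ = b g g * (b f f * b g g - b f g ^+ 2)); last ring.
  by rewrite pmulr_rge0// subr_ge0.
rewrite gg0 mulr0; have [->|fg0] := eqVneq (b f g) 0; first by rewrite expr0n.
(* With [b g g = 0] the form is affine in the coefficient of [g]; this coefficient gives it the
   value -1, which is absurd. *)
have := b_ge0 (1%:H *: f + (- (b f f + 1) / (2 * b f g))%:H *: g).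
rewrite E gg0 mulr0 addr0 expr1n mul1r.
rewrite [X in 0 <= X](_ : _ = - 1); last by field.
by rewrite lerNr oppr0 ler10.
Qed.

End SemidefiniteForms.

(** * The real inner product and its norm *)

Section RealInnerProduct.
Context {R : realType} {V : quatPreHilbertType R}.
Implicit Types (f g h : V) (t : R).

Lemma ripC f g : rip f g = rip g f.
Proof. by rewrite /rip -(inner_conj f g). Qed.

Lemma ripDl f g h : rip (f + g) h = rip f h + rip g h.
Proof. by rewrite /rip innerDl qreD. Qed.

Lemma ripZl t f g : rip (t%:H *: f) g = t * rip f g.
Proof. by rewrite /rip innerZl qre_real_embedM. Qed.

Lemma scalerN1H f : (- 1 : R)%:H *: f = - f.
Proof. by rewrite qreal_embedN scaleNr scale1r. Qed.

Lemma ripNl f g : rip (- f) g = - rip f g.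
Proof. by rewrite -scalerN1H ripZl mulN1r. Qed.

Lemma ripBl f g h : rip (f - g) h = rip f h - rip g h.
Proof. by rewrite ripDl ripNl. Qed.

Lemma ripDr f g h : rip f (g + h) = rip f g + rip f h.
Proof. by rewrite ripC ripDl !(ripC f). Qed.

Lemma ripZr t f g : rip f (t%:H *: g) = t * rip f g.
Proof. by rewrite ripC ripZl ripC. Qed.

Lemma ripNr f g : rip f (- g) = - rip f g.
Proof. by rewrite ripC ripNl ripC. Qed.

Lemma ripBr f g h : rip f (g - h) = rip f g - rip f h.
Proof. by rewrite ripDr ripNr. Qed.

Lemma rip0l g : rip 0 g = 0.
Proof. by rewrite -(subrr 0) ripBl subrr. Qed.

Lemma rip_sumr f (J : Type) (s : seq J) (u : J -> V) :
  rip f (\sum_(i <- s) u i) = \sum_(i <- s) rip f (u i).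
Proof.
elim: s => [|i s IH]; first by rewrite !big_nil ripC rip0l.
by rewrite !big_cons ripDr IH.
Qed.

Lemma rip_suml g (J : Type) (s : seq J) (u : J -> V) :
  rip (\sum_(i <- s) u i) g = \sum_(i <- s) rip (u i) g.
Proof. by rewrite ripC rip_sumr; apply: eq_bigr => i _; rewrite ripC. Qed.

Lemma rip_gt0 f : f != 0 -> 0 < rip f f.
Proof. by move/inner_gt0 => []. Qed.

Lemma rip_ge0 f : 0 <= rip f f.
Proof. by have [->|/rip_gt0/ltW//] := eqVneq f 0; rewrite rip0l. Qed.

Lemma rip_inj f g : (forall h, rip f h = rip g h) -> f = g.
Proof.
move=> H; apply/eqP; rewrite -subr_eq0; apply/eqP.
have [//|/rip_gt0] := eqVneq (f - g) 0.
by rewrite [X in 0 < X]ripBl H subrr ltxx.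
Qed.

Lemma hnorm_ge0 f : 0 <= hnorm f.
Proof. exact: sqrtr_ge0. Qed.

Lemma sqr_hnorm f : hnorm f ^+ 2 = rip f f.
Proof. by rewrite sqr_sqrtr// rip_ge0. Qed.

Lemma hnorm_gt0 f : f != 0 -> 0 < hnorm f.
Proof. by move=> f0; rewrite sqrtr_gt0; exact: rip_gt0. Qed.

Lemma hnorm0 : hnorm (0 : V) = 0.
Proof. by apply/eqP; rewrite -sqrf_eq0 sqr_hnorm rip0l. Qed.

Lemma hnorm_eq0 f : hnorm f = 0 -> f = 0.
Proof. by move=> f0; apply/eqP; apply: contraT => /hnorm_gt0; rewrite f0 ltxx. Qed.

Lemma cauchy_schwarz f g : `|rip f g| <= hnorm f * hnorm g.
Proof.
rewrite -ler_sqr ?nnegrE ?mulr_ge0 ?hnorm_ge0// real_normK ?num_real//.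
rewrite exprMn !sqr_hnorm; apply: (form_cauchy_schwarz (b := rip)).
- exact: ripDl.
- exact: ripZl.
- exact: ripC.
- exact: rip_ge0.
Qed.

Lemma rip_le f g : rip f g <= hnorm f * hnorm g.
Proof. exact: le_trans (ler_norm _) (cauchy_schwarz _ _). Qed.

Lemma hnormZ t f : hnorm (t%:H *: f) = `|t| * hnorm f.
Proof.
apply/eqP; rewrite -(eqrXn2 (n := 2))// ?mulr_ge0 ?hnorm_ge0//.
by rewrite exprMn !sqr_hnorm ripZl ripZr real_normK ?num_real// expr2 mulrA.
Qed.

Lemma hnormN f : hnorm (- f) = hnorm f.
Proof. by rewrite -scalerN1H hnormZ normrN1 mul1r. Qed.

Lemma hnorm_distC f g : hnorm (f - g) = hnorm (g - f).
Proof. by rewrite -opprB hnormN. Qed.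

Lemma hnormD f g : hnorm (f + g) <= hnorm f + hnorm g.
Proof.
rewrite -ler_sqr ?nnegrE ?addr_ge0 ?hnorm_ge0// sqr_hnorm.
rewrite ripDl !ripDr (ripC g f) sqrrD !sqr_hnorm.
have := rip_le f g; lra.
Qed.

Lemma hnorm_dist_triangle g f h : hnorm (f - h) <= hnorm (f - g) + hnorm (g - h).
Proof. by rewrite -[f - h](subrKA g) hnormD. Qed.

(** Since Re (p q) = Re (q p), a quaternionic scalar can cross the real pairing at the price of a
    conjugation. *)
Lemma rip_scale_adj (q : quat R) f g : rip (q *: f) g = rip f (qconj q *: g).
Proof. by rewrite /rip innerZl innerZr qconjK qreMC. Qed.

End RealInnerProduct.

#[local] Existing Instance summability.totally_filter.

(** * Norm convergence and geometrically controlled sequences *)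

Section Convergence.
Context {R : realType} {V : quatPreHilbertType R}.

Lemma hcvgP (T : Type) (F : set_system T) (FF : Filter F) (u : T -> V) (l : V) :
  hcvg F u l <-> forall e, 0 < e -> \forall t \near F, hnorm (u t - l) < e.
Proof.
rewrite /hcvg; split=> [/cvgr0Pnorm_lt H e /H|H].
  by apply: filterS => t; rewrite ger0_norm// hnorm_ge0.
apply/cvgr0Pnorm_lt => e /H.
by apply: filterS => t; rewrite ger0_norm// hnorm_ge0.
Qed.

Lemma hcvg_rip (T : Type) (F : set_system T) {FF : Filter F} (u : T -> V)
    (l g : V) : hcvg F u l -> rip (u t) g @[t --> F] --> rip l g.
Proof.
move=> ul; apply/cvgrPdist_le => e e0.
(* Adding 1 keeps the denominator positive when [g] is 0. *)
have d0 : 0 < e / (hnorm g + 1) by rewrite divr_gt0// ltr_wpDl// hnorm_ge0.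
move/hcvgP: ul => /(_ _ d0); apply: filterS => t /ltW ut.
rewrite -ripBl (le_trans (cauchy_schwarz _ _))// hnorm_distC.
apply: le_trans (ler_wpM2r (hnorm_ge0 _) ut) _.
rewrite mulrAC ler_pdivrMr ?ltr_wpDl ?hnorm_ge0//.
by rewrite ler_pM2l// lerDl.
Qed.

Lemma hcvg_seqP (u : nat -> V) l :
  hcvg \oo u l <-> forall e : R, 0 < e ->
    exists N, forall n, (N <= n)%N -> hnorm (u n - l) < e.
Proof.
split=> [/hcvgP H e /H[N _ HN]|H]; first by exists N => n /HN.
by apply/hcvgP => e /H[N HN]; exists N.
Qed.

End Convergence.

Lemma geometric_small (R : realType) (K r e : R) : 0 <= r < 1 -> 0 < e ->
  exists N, forall n, (N <= n)%N -> K * r ^+ n < e.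
Proof.
move=> /andP[r0 r1] e0.
have : (K * r ^+ n) @[n --> \oo] --> K * 0.
  by apply: cvgM; [exact: cvg_cst|apply: cvg_expr; rewrite ger0_norm].
rewrite mulr0 => /cvgr0Pnorm_lt/(_ _ e0)[N _ HN].
by exists N => n /HN /=; exact/le_lt_trans/ler_norm.
Qed.

Lemma geometric_step_cvg (R : realType) (V : quatHilbertType R) (u : nat -> V)
    (C r : R) : 0 <= r < 1 ->
  (forall n, hnorm (u n.+1 - u n) <= C * r ^+ n) ->
  exists l, forall n, hnorm (l - u n) <= C * r ^+ n / (1 - r).
Proof.
move=> r01 ustep; have /andP[r0 r1] := r01.
have C0 : 0 <= C by have := ustep 0%N; rewrite mulr1; exact/le_trans/hnorm_ge0.
have r1' : 0 < 1 - r by rewrite subr_gt0.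
have dist n k : hnorm (u (n + k)%N - u n) <= C * r ^+ n / (1 - r).
  (* The induction on [k] needs the exact finite geometric sum; the bound without [1 - r ^+ k] does
     not carry over to [k.+1]. *)
  suff: hnorm (u (n + k)%N - u n) <= C * r ^+ n * (1 - r ^+ k) / (1 - r).
    move/le_trans; apply; rewrite ler_pM2r ?invr_gt0//.
    by rewrite ler_piMr ?mulr_ge0 ?exprn_ge0// gerBl exprn_ge0.
  elim: k => [|k IH]; first by rewrite addn0 subrr hnorm0 expr0 subrr mulr0 mul0r.
  apply: le_trans (hnorm_dist_triangle (u (n + k)%N) _ _) _.
  rewrite addnS; apply: le_trans (lerD (ustep _) IH) _.
  rewrite exprD exprS le_eqVlt; apply/orP; left; apply/eqP.
  by field; rewrite lt0r_neq0.
have [|l /hcvg_seqP ul] := hilbert_complete u.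
  move=> e e0; have e20 : 0 < e / 2 by rewrite divr_gt0.
  have [N HN] := geometric_small (C / (1 - r)) r01 e20.
  have H k : (N <= k)%N -> hnorm (u k - u N) < e / 2.
    move=> Nk; rewrite -(subnKC Nk); apply: le_lt_trans (dist _ _) _.
    by rewrite mulrAC HN.
  exists N => m n Nm Nn; rewrite [e]splitr.
  apply: le_lt_trans (hnorm_dist_triangle (u N) _ _) _.
  by rewrite (hnorm_distC _ (u n)); apply: ltrD; exact: H.
exists l => n; apply/ler_addgt0Pr => e /ul[N HN].
apply: le_trans (hnorm_dist_triangle (u (n + N)%N) _ _) _.
rewrite hnorm_distC addrC; apply: lerD; last exact/ltW/HN/leq_addl.
exact: dist.
Qed.

(** * Unordered sums over a countable index set *)

Section UnorderedSums.
Context {R : realType} {I : countType}.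

Lemma near_totallyP (P : set {fset I}) :
  (\forall F \near summability.totally, P F) <->
  exists F0, forall G, (F0 `<=` G)%fset -> P G.
Proof. by split=> [[F0 _ H]|[F0 H]]; exists F0. Qed.

Lemma partial_sumE (W : zmodType) (x : I -> W) (F : {fset I}) :
  summability.partial_sum x F = \sum_(i <- F) x i.
Proof. by rewrite /summability.partial_sum big_seq_fsetE. Qed.

Lemma partial_sum_fsetD (W : zmodType) (x : I -> W) (F G : {fset I}) :
  (F `<=` G)%fset -> summability.partial_sum x G - summability.partial_sum x F =
  summability.partial_sum x (G `\` F)%fset.
Proof.
move=> FG; apply/eqP; rewrite subr_eq addrC !partial_sumE; apply/eqP.
rewrite (big_fsetID _ (mem F) G)/=; congr (_ + _); apply: eq_fbigl => i.
  by rewrite !inE andbC; case: (boolP (i \in F)) => //= /(fsubsetP FG) ->.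
by rewrite !inE andbC.
Qed.

Lemma partial_sum_ge0 (a : I -> R) F : (forall k, 0 <= a k) ->
  0 <= summability.partial_sum a F.
Proof. by move=> a0; rewrite partial_sumE sumr_ge0. Qed.

Lemma partial_sum_le (a : I -> R) (F G : {fset I}) : (forall k, 0 <= a k) ->
  (F `<=` G)%fset ->
  summability.partial_sum a F <= summability.partial_sum a G.
Proof.
by move=> a0 FG; rewrite -subr_ge0 partial_sum_fsetD// partial_sum_ge0.
Qed.

Lemma partial_sum_le_esum (a : I -> R) (F : {fset I}) : (forall k, 0 <= a k) ->
  ((summability.partial_sum a F)%:E <= \esum_(k in [set: I]) (a k)%:E)%E.
Proof.
move=> a0; rewrite partial_sumE; apply: esum_ge; exists [set` F] => //.
by rewrite fsbig_finite//= set_fsetK sumEFin.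
Qed.

Lemma esum_le_partial_sums (a : I -> R) (c : R) :
  (forall F, summability.partial_sum a F <= c) ->
  (\esum_(k in [set: I]) (a k)%:E <= c%:E)%E.
Proof.
move=> ac; apply: ge_ereal_sup => _ [F [finF _] <-].
rewrite fsbig_finite//= sumEFin lee_fin.
by have := ac (fset_set F); rewrite partial_sumE.
Qed.

(** For nonnegative terms the net of partial sums is increasing, so its limit is the supremum
    defining [esum]. *)
Lemma esum_cvg (a : I -> R) (l : R) : (forall k, 0 <= a k) ->
  summability.partial_sum a F @[F --> summability.totally] --> l ->
  \esum_(k in [set: I]) (a k)%:E = l%:E.
Proof.
move=> a0 al; apply/eqP; rewrite eq_le; apply/andP; split.
  apply: esum_le_partial_sums => F.
  apply/ler_addgt0Pr => e e0; move/cvgrPdist_lt: al => /(_ _ e0).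
  move/near_totallyP => [G /(_ (F `|` G)%fset (fsubsetUr _ _))] /=.
  have := partial_sum_le a0 (fsubsetUl F G).
  rewrite ltr_norml => h /andP[h1 h2]; lra.
apply/lee_addgt0Pr => e e0; move/cvgrPdist_lt: al => /(_ _ e0).
move/near_totallyP => [G /(_ G (fsubset_refl _))] /=.
rewrite ltr_norml => /andP[h1 h2].
apply: (@le_trans _ _ ((summability.partial_sum a G)%:E + e%:E)%E).
  by rewrite -EFinD lee_fin; lra.
by rewrite leeD2r// partial_sum_le_esum.
Qed.

Lemma esum_le_scale (a b : I -> R) (c : R) : 0 <= c ->
  (forall k, 0 <= b k) -> (forall k, a k <= c * b k) ->
  (\esum_(k in [set: I]) (a k)%:E <= c%:E * \esum_(k in [set: I]) (b k)%:E)%E.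
Proof.
move=> c0 b0 ab; apply: ge_ereal_sup => _ [F [finF _] <-].
apply: (@le_trans _ _ (c%:E * (summability.partial_sum b (fset_set F))%:E)%E).
  rewrite fsbig_finite//= sumEFin -EFinM lee_fin partial_sumE big_distrr/=.
  by rewrite ler_sum.
by rewrite lee_wpmul2l ?lee_fin// partial_sum_le_esum.
Qed.

(** Completeness speaks of sequences, so finite sets [F n] controlling the net up to 1/(n+1) are
    chosen. Their partial sums form a Cauchy sequence, whose limit is also that of the net. *)
Lemma uncond_sum_cauchy (V : quatHilbertType R) (x : I -> V) :
  (forall e : R, 0 < e -> exists F0 : {fset I}, forall G, (F0 `<=` G)%fset ->
     hnorm (summability.partial_sum x G - summability.partial_sum x F0) < e) ->
  exists s, uncond_sum x s.
Proof.
set P := summability.partial_sum x => H.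
have [F HF] : {F : nat -> {fset I} & forall n G, (F n `<=` G)%fset ->
    hnorm (P G - P (F n)) < n.+1%:R^-1}.
  by apply: (@choice _ _ (fun n F => forall G, (F `<=` G)%fset ->
    hnorm (P G - P F) < n.+1%:R^-1)) => n; apply: H; rewrite invr_gt0.
have inv_small (e : R) : 0 < e ->
    exists N, forall n, (N <= n)%N -> n.+1%:R^-1 < e.
  move=> e0; have [N _ HN] := near_infty_natSinv_lt (PosNum e0).
  by exists N => n /HN.
have [|s /hcvg_seqP Fs] := hilbert_complete (P \o F).
  move=> e e0; have [|N HN] := inv_small (e / 2); first by rewrite divr_gt0.
  exists N => m n Nm Nn /=; rewrite [e]splitr.
  (* The sets [F n] need not be nested, so two of them are compared through their union. *)
  apply: le_lt_trans (hnorm_dist_triangle (P (F m `|` F n)%fset) _ _) _.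
  rewrite (hnorm_distC (P (F m))); apply: ltrD.
    by apply: lt_trans (HN _ Nm); rewrite HF// fsubsetUl.
  by apply: lt_trans (HN _ Nn); rewrite HF// fsubsetUr.
exists s; apply/hcvgP => e e0; have e20 : 0 < e / 2 by rewrite divr_gt0.
have [N HN] := inv_small _ e20; have [M HM] := Fs _ e20.
apply/near_totallyP; exists (F (maxn N M)) => G FG.
apply: le_lt_trans (hnorm_dist_triangle (P (F (maxn N M))) _ _) _.
rewrite [e]splitr; apply: ltrD; last exact/HM/leq_maxr.
by apply: lt_trans (HN _ (leq_maxl _ _)); exact: HF.
Qed.

End UnorderedSums.

(** * Symmetric operators: boundedness, invertibility, positivity *)

Section SymmetricOperators.
Context {R : realType} {V : quatHilbertType R}.

(* Gliding hump: if T is unbounded, pick f_n with ||T f_n|| huge and build a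
   point l as a geometric series of vectors of size 3^-n along +-T f_n, the sign
   being chosen so that |Re <l|T f_n>| stays above 3^-n ||T f_n|| / 2; but this
   quantity is at most ||T l|| ||f_n||. *)
Lemma hellinger_toeplitz (T : V -> V) :
  (forall f g, rip (T f) g = rip f (T g)) ->
  exists2 C, 0 < C & forall f, hnorm (T f) <= C * hnorm f.
Proof.
move=> Tsym; apply: contrapT => Tunb.
(* The factor 2 * 3^n offsets the lower bound 3^-n ||T f_n|| / 2 obtained below, leaving n+1 against
   ||T l||. *)
have [f Hf] : {f : nat -> V & forall n : nat,
    n.+1%:R * 2 * 3 ^+ n * hnorm (f n) < hnorm (T (f n))}.
  apply: (@choice _ _
    (fun n f => n.+1%:R * 2 * 3 ^+ n * hnorm f < hnorm (T f))) => n.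
  apply: contrapT => Hn; apply: Tunb; exists (n.+1%:R * 2 * 3 ^+ n).
    by rewrite !mulr_gt0// exprn_gt0.
  by move=> f; rewrite leNgt; apply/negP => Hf; apply: Hn; exists f.
pose N n := hnorm (T (f n)).
have N0 n : 0 < N n.
  by apply: le_lt_trans (Hf n); rewrite !mulr_ge0 ?exprn_ge0 ?hnorm_ge0.
pose s n (y : V) : R := if 0 <= rip y (T (f n)) then 1 else -1.
have s1 n y : `|s n y| = 1 by rewrite /s; case: ifP; rewrite ?normrN1 ?normr1.
pose x n := iteri n
  (fun i y => y + (s i y * 3^-1 ^+ i * (N i)^-1)%:H *: T (f i)) 0.
have xS n : x n.+1 = x n + (s n (x n) * 3^-1 ^+ n * (N n)^-1)%:H *: T (f n) by [].
have [||l Hl] := @geometric_step_cvg _ _ x 1 3^-1; first by lra.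
  move=> n; rewrite xS addrC addKr hnormZ -/(N n) !normrM s1 mul1r mul1r.
  by rewrite (gtr0_norm (exprn_gt0 _ _))// gtr0_norm ?invr_gt0// mulfVK ?gt_eqF.
have hump n : 3^-1 ^+ n * N n <= `|rip (x n.+1) (T (f n))|.
  have d0 : 0 < 3^-1 ^+ n :> R by rewrite exprn_gt0.
  rewrite xS ripDl ripZl -sqr_hnorm -/(N n).
  rewrite [X in _ + X](_ : _ = s n (x n) * (3^-1 ^+ n * N n)); last first.
    by field; rewrite gt_eqF//= N0.
  have := mulr_gt0 d0 (N0 n); rewrite /s; case: ifPn => [|/negP].
    by move=> h h'; rewrite ger0_norm; lra.
  by move/negP; rewrite -ltNge => h h'; rewrite ltr0_norm; lra.
(* The tail after [x n.+1] has norm at most 3^-(n+1) / (1 - 1/3) = 3^-n / 2, so half of the hump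
   survives in the limit. *)
have lb n : 3^-1 ^+ n * N n / 2 <= hnorm (T l) * hnorm (f n).
  apply: le_trans (cauchy_schwarz _ _); rewrite Tsym.
  have := cauchy_schwarz (x n.+1 - l) (T (f n)); rewrite hnorm_distC -/(N n).
  move/le_trans/(_ (ler_wpM2r (ltW (N0 n)) (Hl n.+1))).
  rewrite ripBl => h.
  have := ler_normB (rip (x n.+1) (T (f n)) - rip l (T (f n)))
    (- rip l (T (f n))).
  rewrite opprK subrK normrN => h'; have := hump n.
  move: h; rewrite [X in _ <= X -> _](_ : _ = 3^-1 ^+ n * N n / 2); last first.
    by rewrite exprS; field.
  lra.
have := archi_boundP (hnorm_ge0 (T l)); set n := Num.bound _ => nT.
have := Hf n; have := lb n; rewrite -/(N n) => h1 h2.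
have : n.+1%:R * hnorm (f n) < hnorm (T l) * hnorm (f n).
  apply: lt_le_trans h1; rewrite ltr_pdivlMr// exprVn ltr_pdivlMl ?exprn_gt0//.
  by apply: le_lt_trans h2; move: (3 ^+ n) n.+1%:R => a b; lra.
apply/negP; rewrite -leNgt ler_wpM2r ?hnorm_ge0// (le_trans (ltW nT))//.
by rewrite ler_nat.
Qed.

Lemma symmetric_coercive_surjective (T : {linear V -> V}) (A : R) : 0 < A ->
  (forall f g, rip (T f) g = rip f (T g)) ->
  (forall f, A * hnorm f ^+ 2 <= rip (T f) f) ->
  forall g, exists f, T f = g.
Proof.
move=> A0 Tsym Tcoer g.
have [C [C0 AC Tbd]] : exists C,
    [/\ 0 < C, A <= C & forall f, hnorm (T f) <= C * hnorm f].
  (* Enlarging the bound by [A] ensures A <= C, so that 1 - (A/C)^2 is nonnegative. *)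
  have [C C0 HC] := hellinger_toeplitz Tsym; exists (C + A); split; [lra|lra|].
  move=> f; apply: le_trans (HC f) _; rewrite ler_wpM2r ?hnorm_ge0//; lra.
(* ||f - t T f||^2 is at most (1 - 2 t A + t^2 C^2) ||f||^2; this [t] minimizes the coefficient, and
   its minimum 1 - (A/C)^2 is the square of [r] below. *)
pose t := A / C ^+ 2.
have t0 : 0 < t by rewrite divr_gt0// exprn_gt0.
pose r := Num.sqrt (1 - (A / C) ^+ 2).
have AC1 : 0 < A / C <= 1 by rewrite divr_gt0//= ler_pdivrMr// mul1r.
have r2 : r ^+ 2 = 1 - (A / C) ^+ 2.
  rewrite sqr_sqrtr// subr_ge0 expr_le1//; lra.
have r01 : 0 <= r < 1.
  rewrite sqrtr_ge0 -(@ltr_pXn2r _ 2)// ?nnegrE ?sqrtr_ge0// r2 expr1n.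
  by rewrite gtrBl exprn_gt0//; case/andP: AC1.
have contr f : hnorm (f - t%:H *: T f) <= r * hnorm f.
  have r0 : 0 <= r by case/andP: r01.
  rewrite -ler_sqr ?nnegrE ?mulr_ge0 ?hnorm_ge0// exprMn r2.
  rewrite [X in X <= _]sqr_hnorm.
  rewrite !ripBr !ripBl !ripZr !ripZl (ripC f) -!sqr_hnorm.
  have h1 : t * (A * hnorm f ^+ 2) <= t * rip (T f) f by rewrite ler_wpM2l// ltW.
  have h2 : t * (t * hnorm (T f) ^+ 2) <= t * (t * (C * hnorm f) ^+ 2).
    rewrite !ler_wpM2l ?(ltW t0)// ler_sqr ?nnegrE ?hnorm_ge0// mulr_ge0 ?hnorm_ge0//.
    exact: ltW.
  have e1 : t * (A * hnorm f ^+ 2) = (A / C) ^+ 2 * hnorm f ^+ 2.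
    by rewrite /t; field; rewrite gt_eqF.
  have e2 : t * (t * (C * hnorm f) ^+ 2) = (A / C) ^+ 2 * hnorm f ^+ 2.
    by rewrite /t; field; rewrite gt_eqF.
  rewrite e1 in h1; rewrite e2 in h2; lra.
pose x n := iter n (fun y => y + t%:H *: (g - T y)) 0.
have xS n : x n.+1 - x n = t%:H *: (g - T (x n)) by rewrite /= addrC addKr.
pose D := hnorm (x 1%N - x 0%N).
have step n : hnorm (x n.+1 - x n) <= D * r ^+ n.
  elim: n => [|n IH]; first by rewrite mulr1.
  rewrite (_ : _ - _ = (x n.+1 - x n) - t%:H *: T (x n.+1 - x n)); last first.
    by rewrite (xS n.+1) linearB (xS n) -scalerBr opprB addrA subrK.
  apply: le_trans (contr _) _; rewrite exprS mulrCA ler_wpM2l//.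
  by case/andP: r01.
have [l Hl] := geometric_step_cvg r01 step.
exists l; apply/eqP; rewrite -subr_eq0; apply/eqP/hnorm_eq0/eqP.
rewrite eq_le hnorm_ge0 andbT; apply/ler_addgt0Pr => e e0; rewrite add0r.
(* The residual T l - g is at most C ||l - x_N|| + t^-1 ||x_(N+1) - x_N||, and both terms decay like
   r^N. *)
have [N HN] := geometric_small (C * (D / (1 - r)) + t^-1 * D) r01 e0.
apply: le_trans (ltW (HN N (leqnn _))).
apply: le_trans (hnorm_dist_triangle (T (x N)) _ _) _; rewrite mulrDl; apply: lerD.
  rewrite -linearB; apply: le_trans (Tbd _) _.
  by rewrite -mulrA ler_pM2l//; apply: le_trans (Hl N) _; rewrite mulrAC.
rewrite hnorm_distC -mulrA -(ler_pM2l t0) mulVKf ?gt_eqF//.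
apply: le_trans (step N); rewrite xS hnormZ ger0_norm//; exact: ltW.
Qed.

(** Coercivity also gives injectivity, through which the right inverse obtained by choice inherits
    linearity and becomes two-sided. *)
Lemma symmetric_coercive_invertible (T : {linear V -> V}) (A : R) : 0 < A ->
  (forall f g, rip (T f) g = rip f (T g)) ->
  (forall f, A * hnorm f ^+ 2 <= rip (T f) f) ->
  invertible_operator T.
Proof.
move=> A0 Tsym Tcoer.
have Tinj : injective T.
  move=> f g Tfg; apply/eqP; rewrite -subr_eq0; apply/eqP/hnorm_eq0/eqP.
  rewrite -sqrf_eq0 eq_le sqr_ge0 andbT -(pmulr_rle0 _ A0).
  by apply: le_trans (Tcoer _) _; rewrite linearB Tfg subrr rip0l.
have [S TS] : {S : V -> V & cancel S T}.
  exact: (choice (symmetric_coercive_surjective A0 Tsym Tcoer)).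
have Slin : linear S.
  by move=> a f g; apply: Tinj; rewrite linearP !TS.
pose Sl := HB.pack_for {linear V -> V} S (GRing.isLinear.Build _ _ _ _ S Slin).
by exists Sl; split => f //=; apply: Tinj; rewrite TS.
Qed.

Lemma positive_invertible_bounds (T : {linear V -> V}) :
  (forall f g, rip (T f) g = rip f (T g)) ->
  (forall f, 0 <= rip (T f) f) -> invertible_operator T ->
  exists A B, [/\ 0 < A, 0 < B & forall f,
    A * hnorm f ^+ 2 <= rip (T f) f <= B * hnorm f ^+ 2].
Proof.
move=> Tsym Tge0 [S [ST TS]].
have Ssym f g : rip (S f) g = rip f (S g) by rewrite -{1}[g]TS -Tsym TS.
have [B B0 HB] := hellinger_toeplitz Tsym.
have [C C0 HC] := hellinger_toeplitz Ssym.
exists C^-1, B; split; rewrite ?invr_gt0// => f; apply/andP; split; last first.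
  apply: le_trans (rip_le _ _) _; rewrite expr2 mulrA.
  by rewrite ler_wpM2r ?hnorm_ge0.
rewrite ler_pdivrMl// sqr_hnorm.
have [->|/rip_gt0 f0] := eqVneq f 0; first by rewrite rip0l linear0 rip0l mulr0.
(* Cauchy-Schwarz for the form Re <T f|g> at the pair (S f, f), where T S f = f. Bounding Re <f|S f>
   by C ||f||^2 then lets one factor ||f||^2 cancel. *)
have : rip f f ^+ 2 <= rip f (S f) * rip (T f) f.
  have := @form_cauchy_schwarz _ _ (fun f g => rip (T f) g) _ _ _ _ (S f) f.
  rewrite /= TS; apply=> // *.
  - by rewrite linearD ripDl.
  - by rewrite linearZ ripZl.
  - by rewrite Tsym ripC.
have : rip f (S f) * rip (T f) f <= C * rip f f * rip (T f) f.
  rewrite ler_wpM2r// (le_trans (rip_le _ _))// -sqr_hnorm expr2 mulrCA.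
  by rewrite ler_wpM2l ?hnorm_ge0.
move=> h1 h2; have := le_trans h2 h1.
by rewrite expr2 mulrAC ler_pM2r.
Qed.

(** Symmetry tested at [q *: f] and [f] gives Re (q <T f|f>) = Re (q <f|T f>) for every quaternion
    q, so <T f|f> equals its conjugate and is real. *)
Lemma symmetric_positive (T : {linear V -> V}) :
  (forall f g, rip (T f) g = rip f (T g)) ->
  (forall f, 0 <= rip (T f) f) -> positive_operator T.
Proof.
move=> Tsym Tge0 f; split; last exact: Tge0.
apply: real_quatP; rewrite inner_conj; apply: qre_mulP => q.
by have := Tsym (q *: f) f; rewrite linearZ /rip !innerZl.
Qed.

End SymmetricOperators.

(** * Multipliers as limits of finite symmetric forms *)

Section Multipliers.
Context {R : realType} {V : quatHilbertType R} {I : countType}.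
Variables (phi : I -> V) (w : I -> R).
Implicit Types (f g h : V) (F : {fset I}).

(** The contribution of index [k] to Re <M f|g> for the multiplier M. *)
Definition frame_term f g (k : I) : R :=
  w k * qre (inner f (phi k) * inner (phi k) g).

Definition frame_form F f g := summability.partial_sum (frame_term f g) F.

Let multiplier_term f (k : I) := (w k)%:H *: (inner f (phi k) *: phi k).

Lemma frame_termC f g k : frame_term f g k = frame_term g f k.
Proof. by rewrite /frame_term -qre_conj qconjM !inner_conj. Qed.

Lemma frame_term_diag f k : frame_term f f k = w k * qabs (inner f (phi k)) ^+ 2.
Proof. by rewrite /frame_term -(inner_conj f) qre_mul_conj. Qed.

Lemma rip_multiplier_sum F f g :
  rip (summability.partial_sum (multiplier_term f) F) g = frame_form F f g.
Proof.
rewrite /frame_form !partial_sumE rip_suml; apply: eq_bigr => k _.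
by rewrite ripZl /rip innerZl.
Qed.

Lemma frame_formC F f g : frame_form F f g = frame_form F g f.
Proof.
by rewrite /frame_form !partial_sumE; apply: eq_bigr => k _; exact: frame_termC.
Qed.

Lemma frame_formDl F f g h :
  frame_form F (f + g) h = frame_form F f h + frame_form F g h.
Proof.
rewrite /frame_form !partial_sumE -big_split/=; apply: eq_bigr => k _.
by rewrite /frame_term innerDl mulrDl qreD mulrDr.
Qed.

Lemma frame_form_adj F (q : quat R) f g :
  frame_form F (q *: f) g = frame_form F f (qconj q *: g).
Proof.
rewrite /frame_form !partial_sumE; apply: eq_bigr => k _.
by rewrite /frame_term innerZl innerZr qconjK mulrA [in RHS]qreMC mulrA.
Qed.

Lemma frame_formZl F (t : R) f g :
  frame_form F (t%:H *: f) g = t * frame_form F f g.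
Proof.
rewrite /frame_form !partial_sumE big_distrr/=; apply: eq_bigr => k _.
by rewrite /frame_term innerZl -mulrA qre_real_embedM mulrCA.
Qed.

Lemma frame_form_cvg_rip f g s : uncond_sum (multiplier_term f) s ->
  frame_form F f g @[F --> summability.totally] --> rip s g.
Proof.
move=> fs; rewrite -(eq_cvg _ _ (fun F => rip_multiplier_sum F f g)).
exact: hcvg_rip.
Qed.

(** The finite forms are symmetric, so both sides are limits of the same net. *)
Lemma multiplier_symmetric (M : {linear V -> V}) : is_multiplier w phi M ->
  forall f g, rip (M f) g = rip f (M g).
Proof.
move=> Mw f g; rewrite (ripC f).
apply: (@cvg_unique _ (@norm_hausdorff R R^o)
  (frame_form F f g @[F --> summability.totally])).
  exact: frame_form_cvg_rip (Mw f).
rewrite /= (eq_cvg _ _ (fun F => frame_formC F f g)).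
exact: frame_form_cvg_rip (Mw g).
Qed.

Hypothesis w_ge0 : forall k, 0 <= w k.

Lemma frame_term_ge0 f k : 0 <= frame_term f f k.
Proof. by rewrite frame_term_diag mulr_ge0 ?sqr_ge0. Qed.

Lemma frame_form_ge0 F f : 0 <= frame_form F f f.
Proof. exact: partial_sum_ge0 (frame_term_ge0 f). Qed.

Lemma esum_multiplier (M : {linear V -> V}) : is_multiplier w phi M ->
  forall f, \esum_(k in [set: I]) (w k * qabs (inner f (phi k)) ^+ 2)%:E =
    (rip (M f) f)%:E.
Proof.
move=> Mw f; under eq_esum do rewrite -frame_term_diag.
apply: esum_cvg; first exact: frame_term_ge0.
exact: frame_form_cvg_rip (Mw f).
Qed.

Variable B : R.
Hypothesis B_gt0 : 0 < B.
Hypothesis form_bounded : forall F f, frame_form F f f <= B * hnorm f ^+ 2.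

(* Writing y for the partial sum over F, [||y||^2] is the value at (f, y) of the
   form attached to F; Cauchy-Schwarz for that form and its bound at (y, y) let
   one factor [||y||^2] cancel. *)
Lemma multiplier_sum_bound F f :
  hnorm (summability.partial_sum (multiplier_term f) F) ^+ 2 <=
  B * frame_form F f f.
Proof.
set y := summability.partial_sum _ F.
have [->|/rip_gt0] := eqVneq y 0.
  by rewrite sqr_hnorm rip0l mulr_ge0 ?frame_form_ge0// ltW.
rewrite -sqr_hnorm => y0; rewrite -(ler_pM2r y0) -expr2.
rewrite {1}sqr_hnorm [in X in X ^+ 2]/y rip_multiplier_sum -/y.
have := @form_cauchy_schwarz _ _ (frame_form F) _ _ _ _ f y.
move=> /(_ (frame_formDl F) (frame_formZl F) (frame_formC F) (frame_form_ge0 F)).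
move/le_trans; apply; rewrite mulrAC [leRHS]mulrC.
by rewrite ler_wpM2l ?frame_form_ge0.
Qed.

(** The increasing scalar net [frame_form F f f] is bounded, so beyond some [F0] its increments are
    small; [multiplier_sum_bound] on [G] minus [F0] turns this into the Cauchy criterion in [V]. *)
Lemma multiplier_sum_exists f : exists s, uncond_sum (multiplier_term f) s.
Proof.
apply: uncond_sum_cauchy => e e0.
pose E := [set frame_form F f f | F in [set: {fset I}]].
have supE : has_sup E.
  split; first by exists (frame_form fset0 f f), fset0.
  by exists (B * hnorm f ^+ 2) => _ [F _ <-].
(* Chosen so that the factor [B] in the bound on the squared norm leaves e^2. *)
have d0 : 0 < e ^+ 2 / B by rewrite divr_gt0 ?exprn_gt0.
have [_ [F0 _ <-] HF0] := sup_adherent d0 supE.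
exists F0 => G FG; rewrite partial_sum_fsetD//.
rewrite -ltr_sqr ?nnegrE ?hnorm_ge0 ?(ltW e0)//.
apply: le_lt_trans (multiplier_sum_bound _ _) _.
rewrite mulrC -ltr_pdivlMr// /frame_form -partial_sum_fsetD// -!/(frame_form _ _ _).
have : frame_form G f f <= sup E by apply: sup_upper_bound => //; exists G.
lra.
Qed.

Lemma multiplier_exists : exists M : {linear V -> V}, is_multiplier w phi M.
Proof.
have [M HM] := choice multiplier_sum_exists.
have Mlin : linear M.
  move=> a f g; apply: rip_inj => h.
  apply: (@cvg_unique _ (@norm_hausdorff R R^o)
    (frame_form F (a *: f + g) h @[F --> summability.totally])).
    exact: frame_form_cvg_rip (HM _).
  (* The scalar [a] is moved onto [h], since a real-valued form cannot be homogeneous in a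
     quaternion. *)
  rewrite /= ripDl rip_scale_adj.
  rewrite (eq_cvg _ _ (fun F => frame_formDl F (a *: f) g h)).
  apply: cvgD; last exact: frame_form_cvg_rip (HM _).
  rewrite (eq_cvg _ _ (fun F => frame_form_adj F a f h)).
  exact: frame_form_cvg_rip (HM _).
by exists (HB.pack_for {linear V -> V} M (GRing.isLinear.Build _ _ _ _ M Mlin)).
Qed.

End Multipliers.

(** * Comparison of two-sided quadratic bounds, and the cycle of implications *)

Section QuadraticBounds.
Context {R : realType} {V : quatHilbertType R} {I : countType}.

(** The common shape of all the conditions except the one on the multiplier; only the coefficients
    inside [a] vary. *)
Definition quadratic_bounds (a : V -> I -> R) : Prop :=
  exists A B : R, [/\ 0 < A, 0 < B & forall f : V,
    ((A * hnorm f ^+ 2)%:E <= \esum_(k in [set: I]) (a f k)%:E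
       <= (B * hnorm f ^+ 2)%:E)%E].

Lemma quadratic_bounds_equiv (a b : V -> I -> R) (c d : R) : 0 < c -> 0 < d ->
  (forall f k, 0 <= a f k) ->
  (forall f k, c * a f k <= b f k <= d * a f k) ->
  quadratic_bounds a -> quadratic_bounds b.
Proof.
move=> c0 d0 a0 cbd [A [B [A0 B0 H]]].
exists (c * A), (d * B); split; rewrite ?mulr_gt0// => f.
have /andP[lA lB] := H f; apply/andP; split.
  rewrite -mulrA EFinM.
  apply: (@le_trans _ _ (c%:E * \esum_(k in [set: I]) (a f k)%:E)%E).
    by rewrite lee_wpmul2l ?lee_fin// ltW.
  rewrite -lee_pdivlMl//; apply: esum_le_scale => [|k|k].
  - by rewrite invr_ge0 ltW.
  - by have /andP[h _] := cbd f k; apply: le_trans h; rewrite mulr_ge0// ltW.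
  - by have /andP[h _] := cbd f k; rewrite ler_pdivlMl.
apply: (@le_trans _ _ (d%:E * \esum_(k in [set: I]) (a f k)%:E)%E).
  apply: esum_le_scale => // [|k]; first exact: ltW.
  by have /andP[_] := cbd f k.
by rewrite -mulrA EFinM lee_wpmul2l ?lee_fin// ltW.
Qed.

Lemma weighted_frame_boundsE (w : I -> R) (phi : I -> V) :
  weighted_frame_bounds w phi <->
  quadratic_bounds (fun f k => w k * qabs (inner f (phi k)) ^+ 2).
Proof.
split=> [[A [B [A0 H]]]|[A [B [A0 B0 H]]]]; last by exists A, B.
(* [weighted_frame_bounds] leaves the sign of [B] free; the maximum with 1 makes it positive. *)
exists A, (Num.max B 1); split=> // [|f]; first by rewrite lt_max ltr01 orbT.
have /andP[-> /le_trans] := H f; apply.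
by rewrite lee_fin ler_wpM2r ?sqr_ge0// le_max lexx.
Qed.

Lemma frame_scaleE (v : I -> R) (phi : I -> V) :
  frame (fun k => (v k)%:H *: phi k) =
  quadratic_bounds (fun f k => v k ^+ 2 * qabs (inner f (phi k)) ^+ 2).
Proof.
rewrite /frame; congr quadratic_bounds; apply/funext => f; apply/funext => k.
by rewrite innerZr qreal_embed_conj sqr_qabs_scale.
Qed.

End QuadraticBounds.

Theorem theorem4p7 (R : realType) (V : quatHilbertType R) (I : countType)
    (phi : I -> V) (w : I -> R)
    (V_separable : separable V)
    (w_gt0 : forall k, 0 < w k)
    (w_semi_normalized : semi_normalized w) :
  [<-> frame phi;
       exists M : {linear V -> V},
         [/\ is_multiplier w phi M, positive_operator M
           & invertible_operator M];
       weighted_frame_bounds w phi;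
       frame (fun k => (Num.sqrt (w k))%:H *: phi k);
       frame (fun k => (w k)%:H *: phi k)].
Proof.
have [a [b [a0 ab w_bounds]]] := w_semi_normalized.
have b0 := lt_le_trans a0 ab.
have w_ge0 k : 0 <= w k by exact: ltW.
have {w_bounds} wab k : a <= w k <= b by rewrite -[w k]ger0_norm.
have c0 f k : 0 <= qabs (inner f (phi k)) ^+ 2 by exact: sqr_ge0.
have wc0 f k : 0 <= w k * qabs (inner f (phi k)) ^+ 2 by rewrite mulr_ge0.
tfae.
- move=> phi_frame.
  have [A [B [A0 B0 H]]] : quadratic_bounds
      (fun f k => w k * qabs (inner f (phi k)) ^+ 2).
    apply: (quadratic_bounds_equiv a0 b0 c0 _ phi_frame) => f k.
    by have /andP[wa wb] := wab k; apply/andP; split; apply: ler_wpM2r.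
  have form_le F f : frame_form phi w F f f <= B * hnorm f ^+ 2.
    rewrite -lee_fin; have /andP[_] := H f; apply: le_trans.
    under eq_esum do rewrite -frame_term_diag.
    by apply: partial_sum_le_esum; exact: frame_term_ge0.
  have [M Mw] := multiplier_exists w_ge0 B0 form_le.
  have Msym := multiplier_symmetric Mw.
  have Mcoer f : A * hnorm f ^+ 2 <= rip (M f) f.
    by rewrite -lee_fin -(esum_multiplier w_ge0 Mw); have /andP[] := H f.
  exists M; split=> //; last exact: symmetric_coercive_invertible Mcoer.
  apply: symmetric_positive => // f; apply: le_trans (Mcoer f).
  by rewrite mulr_ge0 ?sqr_ge0// ltW.
- move=> [M [Mw Mpos Minv]].
  have [|A [B [A0 B0 H]]] :=
    positive_invertible_bounds (multiplier_symmetric Mw) _ Minv.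
    by move=> f; case: (Mpos f).
  exists A, B; split=> // f.
  by rewrite (esum_multiplier w_ge0 Mw) !lee_fin.
- move/weighted_frame_boundsE; rewrite frame_scaleE.
  rewrite (_ : (fun f k => Num.sqrt (w k) ^+ 2 * _) =
    (fun f k => w k * qabs (inner f (phi k)) ^+ 2))//.
  by apply/funext => f; apply/funext => k; rewrite sqr_sqrtr.
(* The coefficients pass from w_k to w_k^2, and their ratio w_k lies in [a, b]. *)
- rewrite !frame_scaleE; apply: (quadratic_bounds_equiv a0 b0) => f k.
    by rewrite sqr_sqrtr.
  have /andP[wa wb] := wab k; rewrite sqr_sqrtr// (expr2 (w k)) -mulrA.
  by apply/andP; split; apply: ler_wpM2r.
- rewrite frame_scaleE.
  (* Passing from w_k^2 back to 1, the ratio w_k^-2 lies between b^-2 and a^-2. *)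
  have a2 : 0 < (b ^+ 2)^-1 by rewrite invr_gt0 exprn_gt0.
  have b2 : 0 < (a ^+ 2)^-1 by rewrite invr_gt0 exprn_gt0.
  apply: (quadratic_bounds_equiv a2 b2) => f k; first by rewrite mulr_ge0 ?sqr_ge0.
  have /andP[wa wb] := wab k.
  rewrite ler_pdivrMl ?exprn_gt0// ler_pdivlMl ?exprn_gt0//.
  by rewrite !ler_wpM2r// ler_sqr ?nnegrE// ltW.
Qed.
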